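(* Let $\lambda>0$, $\nu\in(0,1]$, and for $k\ge 0$, $t>0$ let $$\widehat{p}_k^{\nu}(t)=\lambda^{2k}t^{2k\nu}E_{\nu,2k\nu+1}^{2k+1}(-\lambda t^{\nu})+\lambda^{2k+1}t^{(2k+1)\nu}E_{\nu,(2k+1)\nu+1}^{2k+2}(-\lambda t^{\nu}).$$ Then $(\widehat{p}_k^{\nu}(t))_{k\ge0}$ is the distribution at time $t$ of a renewal process with interarrival density $\widehat{f}_1^{\nu}(t)=\lambda^{2}t^{2\nu-1}E_{\nu,2\nu}^{2}(-\lambda t^{\nu})$, $t>0$. That is, if $\widehat{\mathcal U}_1,\widehat{\mathcal U}_2,\dots$ are i.i.d. positive random variables with density $\widehat f_1^\nu$, $\widehat T_0=0$ and $\widehat{T}_k=\sum_{j=1}^{k}\widehat{\mathcal U}_j$, then for every $k\ge1$ the random variable $\widehat{T}_k$ has density $$\widehat{f}_k^{\nu}(t)=\lambda^{2k}t^{2\nu k-1}E_{\nu,2\nu k}^{2k}(-\lambda t^{\nu}),\qquad t>0,$$ and for every $k\ge 0$ and $t>0$, $$\widehat{p}_k^{\nu}(t)=\Pr\{\widehat{T}_k<t\}-\Pr\{\widehat{T}_{k+1}<t\}.$$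
   Context: The generalized Mittag-Leffler function is $$E_{\alpha,\beta}^{\gamma}(z)=\sum_{r=0}^{\infty}\frac{(\gamma)_r\,z^r}{r!\,\Gamma(\alpha r+\beta)},\qquad \mathrm{Re}(\alpha),\mathrm{Re}(\beta),\mathrm{Re}(\gamma)>0,$$ where $(\gamma)_r=\gamma(\gamma+1)\cdots(\gamma+r-1)$ for $r\ge 1$ and $(\gamma)_0=1$. *)

(* Defs.v *)
From HB Require Import structures.
From mathcomp Require Import all_boot all_order all_algebra.
From mathcomp Require Import finmap.
From mathcomp Require Import all_classical all_reals all_analysis.
Set Implicit Arguments.
Unset Strict Implicit.
Unset Printing Implicit Defensive.
Import Order.TTheory GRing.Theory Num.Theory.
Import numFieldNormedType.Exports.
Local Open Scope classical_set_scope.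
Local Open Scope ring_scope.

(* Euler's integral; meaningful for 0 < x. *)
Definition Gamma_fun (R : realType) (x : R) : R :=
  \int[lebesgue_measure]_(t in `]0, +oo[) (t `^ (x - 1) * expR (- t)).

(* Pochhammer symbol g (g + 1) ... (g + r - 1). *)
Definition rising_factorial (R : realType) (g : R) (r : nat) : R :=
  \prod_(i < r) (g + i%:R).

Definition mittag_leffler_coeff (R : realType) (a b g z : R) : R^nat :=
  [sequence rising_factorial g r * z ^+ r
            / (r`!%:R * Gamma_fun (a * r%:R + b))]_r.

(* E_{a,b}^g(z) for real arguments; the series converges for every z when
   0 < a, 0 < b and 0 < g. *)
Definition mittag_leffler (R : realType) (a b g z : R) : R :=
  limn (series (mittag_leffler_coeff a b g z)).

Definition p_hat (R : realType) (lambda nu : R) (k : nat) (t : R) : R :=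
  lambda ^+ (2 * k) * t `^ (2 * k%:R * nu)
    * mittag_leffler nu (2 * k%:R * nu + 1) (2 * k%:R + 1)
        (- lambda * t `^ nu)
  + lambda ^+ (2 * k + 1) * t `^ ((2 * k%:R + 1) * nu)
    * mittag_leffler nu ((2 * k%:R + 1) * nu + 1) (2 * k%:R + 2)
        (- lambda * t `^ nu).

Definition f_hat (R : realType) (lambda nu : R) (k : nat) (t : R) : R :=
  lambda ^+ (2 * k) * t `^ (2 * nu * k%:R - 1)
    * mittag_leffler nu (2 * nu * k%:R) (2 * k%:R) (- lambda * t `^ nu).

Definition f_hat1 (R : realType) (lambda nu : R) (t : R) : R :=
  lambda ^+ 2 * t `^ (2 * nu - 1)
    * mittag_leffler nu (2 * nu) 2 (- lambda * t `^ nu).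

(* X has density f on the open half-line, and density 0 elsewhere; the values
   of f at t <= 0 are ignored. *)
Definition has_density_pos (d : measure_display) (T : measurableType d)
    (R : realType) (P : probability T R) (X : {RV P >-> R}) (f : R -> R) :
    Prop :=
  [/\ measurable_fun (`]0, +oo[ : set R) f,
      (forall t : R, 0 < t -> 0 <= f t) &
      forall A : set R, measurable A ->
        distribution P X A =
          (\int[lebesgue_measure]_(t in A `&` `]0%R, +oo[) (f t)%:E)%E].

Arguments has_density_pos {d T R} P X f.

Definition mutually_independent (d : measure_display) (T : measurableType d)
    (R : realType) (P : probability T R) (X : nat -> {RV P >-> R}) : Prop :=
  forall (J : {fset nat}) (B : nat -> set R),
    (forall j, measurable (B j)) ->
    P (\bigcap_(j in [set` J]) (X j @^-1` B j)) =
      (\prod_(j <- J) P (X j @^-1` B j))%E.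

Definition iid (d : measure_display) (T : measurableType d)
    (R : realType) (P : probability T R) (X : nat -> {RV P >-> R}) : Prop :=
  mutually_independent X /\
  forall (i j : nat) (A : set R), measurable A ->
    distribution P (X i) A = distribution P (X j) A.

(* T_k = U_1 + ... + U_k, where U_j is [U (j - 1)]; in particular T_0 = 0. *)
Definition arrival_time (d : measure_display) (T : measurableType d)
    (R : realType) (P : probability T R) (U : nat -> {RV P >-> R})
    (k : nat) (w : T) : R :=
  \sum_(j < k) U j w.

Lemma measurable_arrival_time (d : measure_display) (T : measurableType d)
    (R : realType) (P : probability T R) (U : nat -> {RV P >-> R}) (k : nat) :
  measurable_fun [set: T] (arrival_time U k).
Proof. by apply: measurable_sum => j; exact: measurable_funPT. Qed.

HB.instance Definition _ (d : measure_display) (T : measurableType d)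
    (R : realType) (P : probability T R) (U : nat -> {RV P >-> R}) (k : nat) :=
  isMeasurableFun.Build _ _ _ _ (arrival_time U k)
    (measurable_arrival_time U k).

(* Main.v *)
Require Import Defs.
From HB Require Import structures.
From mathcomp Require Import all_boot all_order all_algebra.
From mathcomp Require Import finmap.
From mathcomp Require Import all_classical all_reals all_analysis.
From mathcomp Require Import measurable_realfun.
From mathcomp Require Import ring lra.
Set Implicit Arguments.
Unset Strict Implicit.
Unset Printing Implicit Defensive.
Import Order.TTheory GRing.Theory Num.Theory.
Import numFieldNormedType.Exports.
Local Open Scope classical_set_scope.
Local Open Scope ring_scope.

(** With g_a(t) = t^(a-1) / Gamma(a) for t > 0 and 0 elsewhere, both the
    densities and the distribution functions of the arrival times are series
    sum_r c_r g_(a + nu r)(t) whose coefficients grow at most geometrically.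
    Euler's Beta integral says g_a * g_b = g_(a+b) for convolution, so such
    series convolve by adding the offsets a, b and taking the Cauchy product of
    the coefficients.  The coefficients of f_k are, up to a power of lambda,
    those of (1 + lambda x)^(-2k), hence f_k * f_1 = f_(k+1); convolving with
    g_1, the indicator of ]0, +oo[, integrates f_k and gives Pr(T_k < t).
    The formula for p_k is Pascal's rule
    (1+x)^(-g) = (1+x)^(-g-1) + x (1+x)^(-g-1), used for g = 2k and g = 2k+1. *)

(** * The Gamma integral *)

(** The argument -lambda t^nu makes every Mittag-Leffler series here alternate, and this shapes the
    analysis. Monotone convergence cannot exchange sum and integral, so [integral_series_cvg] relies
    on dominated convergence; the integral of the dominating function is controlled by the same
    convolution formula with [|c r|] and [|d r|] as coefficients, which is why [geom_bounded]
    ignores signs. Nor is [f_hat] visibly nonnegative: for k = 1 this is part of the hypothesis on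
    the interarrival density, and for larger k it follows from being a convolution of nonnegative
    functions. The convolution identities hold pointwise in t, so no transform and no inversion
    theorem intervenes. On the probabilistic side the density of T_k + U_k requires the joint law of
    the pair, which is identified through uniqueness of the product measure. *)

Lemma ge0_integral_affine (R : realType) (c e : R) (f : R -> \bar R) :
  0 < c -> measurable_fun [set: R] f -> (forall x, (0 <= f x)%E) ->
  (\int[lebesgue_measure]_x f x =
   c%:E * \int[lebesgue_measure]_x f (c * x + e)%R)%E.
Proof.
move=> c0 mf f0.
pose phi : R -> measurableTypeR R := fun x => c * x + e.
have mphi : measurable_fun [set: R] phi.
  by apply: measurable_funD => //; exact: measurable_funM.
pose nu := mscale (NngNum (ltW c0)) (pushforward lebesgue_measure phi).
(* Lebesgue measure is c times its pushforward under [phi]: both give a half-open interval its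
   length, and this determines the measure. *)
have E (A : set (measurableTypeR R)) : measurable A -> lebesgue_measure A = nu mphi A.
  apply: lebesgue_measure_unique => _ [[x y] _ <-] /=.
  rewrite /nu /mscale /pushforward /=.
  have -> : pushforward lebesgue_measure phi `]x, y]%classic =
      lebesgue_measure `](x - e) / c, (y - e) / c]%classic.
    congr (lebesgue_measure _).
    apply/seteqP; split => z /=; rewrite !in_itv/= /phi ltr_pdivrMr//;
      rewrite ler_pdivlMr// ltrBlDr lerBrDr mulrC//.
  rewrite !lebesgue_measure_itv/= !lte_fin ltr_pM2r ?invr_gt0// ltrD2r.
  case: ifPn => _; last by rewrite mule0.
  by rewrite -!EFinB -EFinM; congr EFin; field; rewrite gt_eqF.
rewrite (@eq_measure_integral _ _ _ setT (nu mphi)); last by move=> A mA _; exact: E.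
rewrite ge0_integral_mscale//; congr (_ * _)%E.
by rewrite ge0_integral_pushforward//.
Qed.

(** The antiderivative x^a / a need not be differentiable at 0, so the fundamental theorem is
    applied on intervals exhausting ]0, 1], where dropping the term at the left end gives a bound
    uniform in n. *)
Lemma integral_powR_unit (R : realType) (a : R) : 0 < a ->
  (\int[lebesgue_measure]_(x in `]0%R, 1%R]) (x `^ (a - 1))%:E
    <= (a^-1)%:E :> \bar R)%E.
Proof.
move=> a0.
(* With [n.+2] every left end is strictly below 1, as the fundamental theorem requires. *)
pose F (n : nat) : set R := `[(n.+2%:R^-1 : R), 1]%classic.
have n20 n : 0 < n.+2%:R^-1 :> R by rewrite invr_gt0.
have mpow : measurable_fun [set: R] (fun x : R => (x `^ (a - 1))%:E).
  by apply/measurable_EFinP; exact: measurable_powR.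
have FE : `]0%R, 1%R]%classic = \bigcup_n F n.
  apply/seteqP; split => [x /=|x [n _]]; rewrite /F /= !in_itv/=.
    move=> /andP[x0 x1]; exists (Num.truncn x^-1) => //=.
    rewrite in_itv/= x1 andbT invf_ple ?posrE//.
    by rewrite (le_trans (ltW (truncnS_gt _)))// ler_nat.
  by move=> /andP[nx ->]; rewrite (lt_le_trans _ nx).
have der (p x : R) : 0 < x -> derivable (@powR R ^~ p) x 1.
  by move=> x0; apply: derivable_powR; rewrite in_itv/= x0.
have ctn (p x : R) : 0 < x -> {for x, continuous (@powR R ^~ p)}.
  move=> x0; apply: differentiable_continuous; apply/derivable1_diffP.
  exact: der.
have Fle n : (\int[lebesgue_measure]_(x in F n) (x `^ (a - 1))%:E
    <= (a^-1)%:E)%E.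
  have n1 : n.+2%:R^-1 < 1 :> R by rewrite invf_lt1// ltr1n.
  rewrite (@continuous_FTC2 _ _ (fun x : R => a^-1 * x `^ a))//.
  - by rewrite powR1 mulr1 -EFinB lee_fin gerBl mulr_ge0 ?invr_ge0 ?powR_ge0// ltW.
  - apply: derivable_within_continuous => x; rewrite in_itv/= => /andP[nx _].
    by apply: der; exact: lt_le_trans nx.
  - split.
    + move=> x; rewrite in_itv/= => /andP[nx _].
      by apply: derivableM => //; apply: der; exact: lt_trans nx.
    + by apply: cvg_at_right_filter; apply: cvgM; [exact: cvg_cst|exact: ctn].
    + by apply: cvg_at_left_filter; apply: cvgM; [exact: cvg_cst|exact: ctn].
  - move=> x; rewrite in_itv/= => /andP[nx _].
    have x0 : 0 < x by exact: lt_trans nx.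
    rewrite derive1Ml; last exact: der.
    by rewrite powR_derive1 ?in_itv/= ?x0// mulrA mulVf ?mul1r// gt_eqF.
have cvF : (\int[lebesgue_measure]_(x in F i) (x `^ (a - 1))%:E)%E @[i --> \oo]
    --> (\int[lebesgue_measure]_(x in \bigcup_n F n) (x `^ (a - 1))%:E)%E.
  apply: (@ge0_nondecreasing_set_cvg_integral _ (measurableTypeR R)).
  - apply/nondecreasing_seqP => n; rewrite subsetEset => x /=.
    rewrite /F /= !in_itv/= => /andP[nx ->]; rewrite andbT (le_trans _ nx)//.
    by rewrite lef_pV2 ?posrE// ler_nat.
  - by move=> n; exact: measurable_itv.
  - by move=> n; apply: measurable_funS mpow.
  - by move=> n x _; rewrite lee_fin powR_ge0.
rewrite FE -(cvg_lim _ cvF)//; apply: lime_le; first by apply/cvg_ex; eexists; exact: cvF.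
exact: nearW.
Qed.

(* Extended by 0, so that convolutions over [0, t] become integrals over the
   whole line. *)
Definition power_kernel (R : realType) (a : R) : R -> R :=
  (fun x => x `^ (a - 1)) \_ `]0, +oo[.

Section power_kernel.
Context {R : realType}.
Implicit Types a b x y M : R.
Local Notation mu := (@lebesgue_measure R).

Lemma power_kernelE a x : 0 < x -> power_kernel a x = x `^ (a - 1).
Proof. by move=> x0; rewrite /power_kernel patchE mem_set//= in_itv/= x0. Qed.

Lemma power_kernel_le0 a x : x <= 0 -> power_kernel a x = 0.
Proof.
by move=> x0; rewrite /power_kernel patchE memNset//=; apply/negP; rewrite in_itv/= andbT -leNgt.
Qed.

Lemma power_kernel_ge0 a x : 0 <= power_kernel a x.
Proof. by rewrite /power_kernel patchE; case: ifP => // _; exact: powR_ge0. Qed.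

Lemma measurable_power_kernel a : measurable_fun [set: R] (power_kernel a).
Proof.
apply/(measurable_restrictT _ _).1; first exact: measurable_itv.
by apply: measurable_funS (measurable_powR _).
Qed.

Lemma power_kernelZ a c x : 0 < c ->
  power_kernel a (c * x) = c `^ (a - 1) * power_kernel a x.
Proof.
move=> c0; have [x0|x0] := ltP 0 x; last first.
  by rewrite !power_kernel_le0 ?mulr0// pmulr_rle0.
by rewrite !power_kernelE ?mulr_gt0// powRM// ltW.
Qed.

(** Only half of the decay of exp(-x) is spent on the power; what is left, exp(-x/2), is twice the
    exponential density of rate 1/2 and hence integrable. *)
Lemma powR_expR_le a : exists K : R, 0 <= K /\
  forall x, 1 <= x -> x `^ (a - 1) <= K * expR (x / 2).
Proof.
pose n := Num.truncn `|a|.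
(* The exponent [n.+1] exceeds a - 1, and the constant comes from (x/2)^(n+1) / (n+1)! <=
   exp(x/2). *)
exists ((2 ^+ n.+1) * n.+1`!%:R); split; first by rewrite mulr_ge0// exprn_ge0.
move=> x x1; have x0 : 0 <= x by exact: le_trans x1.
apply: (@le_trans _ _ (x ^+ n.+1)).
  rewrite -powR_mulrn// ler_powR//.
  have := ltW (truncnS_gt `|a|); have := ler_norm a; rewrite -/n; lra.
have f0 : 0 < (n.+1`!)%:R :> R by rewrite ltr0n fact_gt0.
have := @expR_ge1Dxn _ (x / 2) n ltac:(by rewrite divr_ge0).
rewrite -mulrA -ler_pdivrMl ?exprn_gt0// -ler_pdivrMl//.
rewrite exprMn exprVn [X in 1 + X <= _](_ : _ =
  (n.+1`!)%:R^-1 * ((2 ^+ n.+1)^-1 * x ^+ n.+1)); last by ring.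
by apply: le_trans; rewrite lerDr.
Qed.

(** [Gamma_fun] is a real-valued integral, which would silently be 0 if the extended integral were
    infinite; finiteness is what ties it to Euler's integral. The majorant is x^(a-1) on ]0, 1] plus
    a multiple of an exponential density. *)
Lemma gamma_integral_lty a : 0 < a ->
  (\int[mu]_x (power_kernel a x * expR (- x))%:E < +oo)%E.
Proof.
move=> a0; have [K [K0 HK]] := powR_expR_le a.
have r0 : 0 < 2^-1 :> R by rewrite invr_gt0.
pose u x := (power_kernel a \_ `]0%R, 1%R]) x.
pose v x := K * 2 * exponential_pdf 2^-1 x.
have mk := measurable_power_kernel a.
have mu_ : measurable_fun [set: R] u.
  apply/(measurable_restrictT _ _).1; first exact: measurable_itv.
  exact: measurable_funS mk.
have u0 x : 0 <= u x by rewrite /u patchE; case: ifP => // _; exact: power_kernel_ge0.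
have v0 x : 0 <= v x by rewrite !mulr_ge0// exponential_pdf_ge0.
have mv : measurable_fun [set: R] v.
  by apply: measurable_funM => //; exact: measurable_exponential_pdf.
apply: (@le_lt_trans _ _ (\int[mu]_x ((u x)%:E + (v x)%:E))%E).
  apply: ge0_le_integral => //.
  - by move=> x _; rewrite lee_fin mulr_ge0 ?expR_ge0// power_kernel_ge0.
  - apply/measurable_EFinP; apply: measurable_funM => //.
    by apply: measurableT_comp => //; exact: measurable_expR.
  - by apply: emeasurable_funD; exact/measurable_EFinP.
  - move=> x _; rewrite -EFinD lee_fin.
    have [x0|x0] := leP x 0; first by rewrite power_kernel_le0// mul0r addr_ge0.
    have [x1|x1] := leP x 1.
      apply: ler_wpDr => //; rewrite /u patchE mem_set/= ?in_itv/= ?x0//.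
      by rewrite ler_piMr ?power_kernel_ge0// expR_le1 oppr_le0 ltW.
    apply: ler_wpDl => //; rewrite power_kernelE// /v exponential_pdfE; last exact: ltW.
    apply: (@le_trans _ _ (K * expR (x / 2) * expR (- x))).
      by rewrite ler_wpM2r ?expR_ge0// HK// ltW.
    rewrite -!mulrA (mulrA 2) mulfV// mul1r -expRD.
    by rewrite (_ : x / 2 - x = - 2^-1 * x)//; lra.
rewrite ge0_integralD//; last 4 first.
- by move=> x _; rewrite lee_fin.
- exact/measurable_EFinP.
- by move=> x _; rewrite lee_fin.
- exact/measurable_EFinP.
apply: lte_add_pinfty.
  rewrite (_ : (\int[mu]_x _)%E =
    (\int[mu]_(x in `]0%R, 1%R]) (x `^ (a - 1))%:E)%E).
    exact: le_lt_trans (integral_powR_unit a0) (ltry _).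
  rewrite [RHS]integral_mkcond; apply: eq_integral => x _.
  rewrite /u !patchE; case: ifPn => //; rewrite inE/= in_itv/= => /andP[x0 _].
  by rewrite power_kernelE.
under eq_integral do rewrite EFinM.
rewrite ge0_integralZl//; last 3 first.
- by apply/measurable_EFinP; exact: measurable_exponential_pdf.
- by move=> x _; rewrite lee_fin exponential_pdf_ge0.
- by rewrite lee_fin mulr_ge0.
by rewrite integral_exponential_pdf// mule1 ltry.
Qed.

Lemma Gamma_funE a : 0 < a ->
  (Gamma_fun a)%:E = (\int[mu]_x (power_kernel a x * expR (- x))%:E)%E.
Proof.
move=> a0; rewrite /Gamma_fun /Rintegral.
have -> : (\int[mu]_(t in `]0%R, +oo[) (t `^ (a - 1) * expR (- t))%:E =
    \int[mu]_x (power_kernel a x * expR (- x))%:E)%E.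
  rewrite integral_mkcond; apply: eq_integral => x _.
  by rewrite /power_kernel !patchE; case: ifPn => //; rewrite mul0r.
rewrite fineK// ge0_fin_numE ?gamma_integral_lty//.
by apply: integral_ge0 => x _; rewrite lee_fin mulr_ge0 ?expR_ge0// power_kernel_ge0.
Qed.

(** A substitute for Stirling's formula: since M is free, Gamma outgrows every geometric sequence.
    Euler's integrand is bounded below on [M, M + 1] alone; writing x^(a-1) as x^a / x avoids a case
    split on the sign of a - 1. *)
Lemma Gamma_fun_ge M a : 0 < M -> 0 < a ->
  M `^ a / (M + 1) * expR (- (M + 1)) <= Gamma_fun a.
Proof.
move=> M0 a0; rewrite -lee_fin Gamma_funE//.
set c := _ * _.
have -> : c%:E = (\int[mu]_x ((cst c%:E) \_ `[M, (M + 1)%R]) x)%E.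
  rewrite -integral_mkcond integral_cst//.
  rewrite [X in (_ * X)%E](_ : _ = 1%:E) ?mule1//.
  transitivity (mu `[M, M + 1]%classic) => //.
  rewrite lebesgue_measure_itv/= lte_fin ltrDl ltr01 -EFinB.
  by congr EFin; ring.
have c0 : 0 <= c by rewrite !mulr_ge0 ?expR_ge0 ?powR_ge0 ?invr_ge0 ?addr_ge0// ltW.
apply: ge0_le_integral => //.
- by move=> x _; rewrite patchE; case: ifP => // _; rewrite lee_fin.
- apply/(measurable_restrictT _ _).1; first exact: measurable_itv.
  exact: measurable_cst.
- apply/measurable_EFinP; apply: measurable_funM => //.
    exact: measurable_power_kernel.
  by apply: measurableT_comp => //; exact: measurable_expR.
- move=> x _; rewrite patchE; case: ifPn; last first.
    by rewrite lee_fin mulr_ge0 ?expR_ge0// power_kernel_ge0.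
  rewrite inE/= in_itv/= => /andP[Mx xM]; rewrite lee_fin.
  have x0 : 0 < x by exact: lt_le_trans Mx.
  rewrite power_kernelE// powRB; last by rewrite (gt_eqF x0) implybT.
  rewrite powRr1; last exact: ltW.
  rewrite /c ler_pM ?expR_ge0//.
  + by rewrite divr_ge0 ?powR_ge0// addr_ge0// ltW.
  + rewrite ler_pM ?powR_ge0//.
    * by rewrite invr_ge0 addr_ge0// ltW.
    * by rewrite ge0_ler_powR// ?nnegrE; exact: ltW.
    * by rewrite lef_pV2 ?posrE// addr_gt0.
  + by rewrite ler_expR lerN2.
Qed.

Lemma Gamma_fun_gt0 a : 0 < a -> 0 < Gamma_fun a.
Proof.
move=> a0; apply: lt_le_trans (Gamma_fun_ge ltr01 a0).
by rewrite powR1 !mulr_gt0 ?expR_gt0 ?invr_gt0 ?addr_gt0.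
Qed.

End power_kernel.

(** * The Beta integral *)

Section convolution.
Context {R : realType}.
Implicit Types f g phi : R -> R.
Local Notation mu := (@lebesgue_measure R).

(** Translation y = z - x followed by Tonelli. The weight [phi] is exp(-z) for the Beta integral and
    the indicator of an event for the law of a sum. *)
Lemma ge0_integral_convolution phi f g :
  measurable_fun [set: R] phi -> measurable_fun [set: R] f ->
  measurable_fun [set: R] g ->
  (forall x, 0 <= phi x) -> (forall x, 0 <= f x) -> (forall x, 0 <= g x) ->
  (\int[mu]_x \int[mu]_y (phi (x + y) * (f x * g y))%:E =
   \int[mu]_z ((phi z)%:E * \int[mu]_x (f x * g (z - x))%:E))%E.
Proof.
move=> mphi mf mg phi0 f0 g0.
transitivity (\int[mu]_x \int[mu]_z (phi z * (f x * g (z - x)))%:E)%E.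
  apply: eq_integral => x _.
  rewrite (@ge0_integral_affine _ 1 (- x))//; first last.
  - by move=> y; rewrite lee_fin !mulr_ge0.
  - apply/measurable_EFinP; apply: measurable_funM.
      by apply: measurableT_comp => //; exact: measurable_funD.
    exact: measurable_funM.
  rewrite mul1e; apply: eq_integral => z _.
  by rewrite mul1r addrCA subrr addr0.
have mh : measurable_fun [set: R * R]
    (fun p : R * R => (phi p.2 * (f p.1 * g (p.2 - p.1)))%:E).
  apply/measurable_EFinP; apply: measurable_funM.
    by apply: measurableT_comp => //; exact: measurable_snd.
  apply: measurable_funM; first by apply: measurableT_comp => //; exact: measurable_fst.
  apply: measurableT_comp => //; apply: measurable_funB.
    exact: measurable_snd.
  exact: measurable_fst.
have h0 p : (0 <= (phi p.2 * (f p.1 * g (p.2 - p.1)))%:E)%E.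
  by rewrite lee_fin !mulr_ge0.
rewrite (@fubini_tonelli _ _ _ _ R mu mu _ mh h0).
apply: eq_integral => z _; rewrite /fubini_G /=.
under eq_integral do rewrite EFinM.
rewrite ge0_integralZl//.
- apply/measurable_EFinP; apply: measurable_funM => //.
  by apply: measurableT_comp => //; exact: measurable_funB.
- by move=> x _; rewrite lee_fin mulr_ge0.
- by rewrite lee_fin.
Qed.

End convolution.

Section beta_integral.
Context {R : realType}.
Implicit Types a b t : R.
Local Notation mu := (@lebesgue_measure R).

Let beta_conv a b t := (\int[mu]_x (power_kernel a x * power_kernel b (t - x))%:E)%E.

(** Homogeneity, by the substitution x = t x'. The remaining constant [beta_conv a b 1] is the Beta
    integral B(a, b). *)
Let beta_conv_scale a b t : 0 < a -> 0 < b ->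
  beta_conv a b t = ((power_kernel (a + b) t)%:E * beta_conv a b 1)%E.
Proof.
move=> a0 b0; have mk (c : R) := measurable_power_kernel c.
have m1 s : measurable_fun [set: R] (fun x => (power_kernel a x * power_kernel b (s - x))%:E).
  apply/measurable_EFinP; apply: measurable_funM => //.
  by apply: measurableT_comp => //; exact: measurable_funB.
have k0 s x : (0 <= (power_kernel a x * power_kernel b (s - x))%:E)%E.
  by rewrite lee_fin mulr_ge0 ?power_kernel_ge0.
have [t0|t0] := ltP 0 t; last first.
  rewrite power_kernel_le0// mul0e; apply: integral0_eq => x _.
  have [x0|x0] := leP x 0; first by rewrite (power_kernel_le0 _ x0) mul0r.
  by rewrite (@power_kernel_le0 _ b) ?mulr0//; lra.
transitivity (t%:E * \int[mu]_x
    (power_kernel a (t * x + 0) * power_kernel b (t - (t * x + 0)))%:E)%E.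
  exact: (ge0_integral_affine 0 t0 (m1 t) (k0 t)).
have E x : ((power_kernel a (t * x + 0) * power_kernel b (t - (t * x + 0)))%:E =
    (t `^ (a - 1) * t `^ (b - 1))%:E *
      (power_kernel a x * power_kernel b (1 - x))%:E)%E.
  rewrite addr0 -{2}(mulr1 t) -mulrBr !power_kernelZ// -EFinM; congr EFin; ring.
under eq_integral do rewrite E.
rewrite ge0_integralZl//; last 2 first.
- exact: m1.
- by rewrite lee_fin mulr_ge0 ?powR_ge0.
rewrite muleA -EFinM power_kernelE//; congr (_%:E * _)%E.
rewrite -{1}[t]powRr1; last exact: ltW.
have tD r s : t `^ (r + s) = t `^ r * t `^ s.
  by rewrite powRD// (gt_eqF t0) implybT.
rewrite -!tD; congr (_ `^ _); ring.
Qed.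

Lemma power_kernel_convolution a b t : 0 < a -> 0 < b ->
  (\int[mu]_x (power_kernel a x * power_kernel b (t - x))%:E)%E =
  (Gamma_fun a * Gamma_fun b / Gamma_fun (a + b) * power_kernel (a + b) t)%:E.
Proof.
move=> a0 b0; rewrite -/(beta_conv a b t) beta_conv_scale//.
have ab0 : 0 < a + b by exact: addr_gt0.
have mk (c : R) := measurable_power_kernel c.
have mexp : measurable_fun [set: R] (fun x : R => expR (- x)).
  by apply: measurableT_comp => //; exact: measurable_expR.
(* The identity Gamma(a) Gamma(b) = B(a, b) Gamma(a + b) is kept in the extended reals because B(a,
   b) is not yet known to be finite; its finiteness comes out on multiplying by the inverse of
   Gamma(a + b). *)
suff H : ((Gamma_fun a)%:E * (Gamma_fun b)%:E =
    beta_conv a b 1 * (Gamma_fun (a + b))%:E)%E.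
  have Gab := Gamma_fun_gt0 ab0.
  have -> : beta_conv a b 1 = (Gamma_fun a * Gamma_fun b / Gamma_fun (a + b))%:E.
    rewrite EFinM EFinM H -muleA -EFinM mulfV ?mule1//.
    by rewrite gt_eqF.
  by rewrite -EFinM mulrC.
transitivity (\int[mu]_x \int[mu]_y
    (expR (- (x + y)) * (power_kernel a x * power_kernel b y))%:E)%E.
  rewrite (Gamma_funE a0) -ge0_integralZr//; last 3 first.
  - by apply/measurable_EFinP; exact: measurable_funM (mk _) _.
  - by move=> x _; rewrite lee_fin mulr_ge0 ?expR_ge0 ?power_kernel_ge0.
  - by rewrite lee_fin ltW// Gamma_fun_gt0.
  apply: eq_integral => x _.
  rewrite (Gamma_funE b0) -ge0_integralZl//; last 3 first.
  - by apply/measurable_EFinP; exact: measurable_funM (mk _) _.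
  - by move=> y _; rewrite lee_fin mulr_ge0 ?expR_ge0 ?power_kernel_ge0.
  - by rewrite lee_fin mulr_ge0 ?expR_ge0 ?power_kernel_ge0.
  apply: eq_integral => y _; rewrite -EFinM opprD expRD; congr EFin; ring.
rewrite (ge0_integral_convolution mexp)//; try by move=> *; rewrite ?expR_ge0 ?power_kernel_ge0.
have C1 : (0 <= beta_conv a b 1)%E.
  by apply: integral_ge0 => x _; rewrite lee_fin mulr_ge0 ?power_kernel_ge0.
rewrite (Gamma_funE ab0) muleC.
transitivity (\int[mu]_x
    ((power_kernel (a + b) x * expR (- x))%:E * beta_conv a b 1))%E.
  apply: eq_integral => z _; rewrite -/(beta_conv a b z) beta_conv_scale//.
  by rewrite muleA -EFinM mulrC.
apply: ge0_integralZr => //.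
- by apply/measurable_EFinP; apply: measurable_funM; [exact: mk|exact: mexp].
- by move=> x _; rewrite lee_fin mulr_ge0 ?expR_ge0 ?power_kernel_ge0.
Qed.

Lemma Gamma_fun1 : Gamma_fun (1 : R) = 1.
Proof.
apply: EFin_inj; rewrite Gamma_funE// -(@integral_exponential_pdf R 1)//.
transitivity (\int[mu]_(x in `]0%R, +oo[) (expR (- x))%:E)%E.
  rewrite [RHS]integral_mkcond; apply: eq_integral => x _.
  rewrite /power_kernel !patchE; case: ifPn => _; last by rewrite mul0r.
  by rewrite subrr powRr0 mul1r.
rewrite integral_itv_obnd_cbnd.
  rewrite integral_mkcond; apply: eq_integral => x _.
  rewrite /exponential_pdf !patchE; case: ifPn => // _.
  by rewrite mulN1r mul1r.
apply: measurable_funTS; apply/measurable_EFinP.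
by apply: measurableT_comp => //; exact: measurable_expR.
Qed.

End beta_integral.

(** * Cauchy products *)

Section cauchy_product.
Context {R : realType}.
Implicit Types x y : R^nat.

Definition cauchy_product x y : R^nat :=
  fun m => \sum_(i < m.+1) x i * y (m - i)%N.

Lemma series_cauchy_product x y n :
  series (cauchy_product x y) n = \sum_(i < n) x i * series y (n - i)%N.
Proof.
elim: n => [|n IH]; first by rewrite /series/= big_geq// big_ord0.
rewrite seriesSr IH [RHS]big_ord_recr/= subSn// subnn.
rewrite {3}/series/= big_nat1 /cauchy_product big_ord_recr/= subnn addrA; congr +%R.
rewrite -big_split/=; apply: eq_bigr => i _.
by rewrite subSn 1?ltnW// seriesSr mulrDr.
Qed.

(** Mertens' theorem. The error is the sum of x_i times the tail Y - Y_(n-i). For i < I the tail is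
    small, since n >= I + J forces n - i >= J; for i >= I the tail is merely bounded by E, but the
    sum of the |x_i| is small. *)
Lemma cvg_cauchy_product x y (X Y : R) :
  cvgn [normed series x] -> series x @ \oo --> X -> series y @ \oo --> Y ->
  series (cauchy_product x y) @ \oo --> X * Y.
Proof.
move=> nx cx cy.
suff H : \sum_(i < n) x i * (Y - series y (n - i)%N) @[n --> \oo] --> (0 : R).
  have -> : series (cauchy_product x y) = fun n =>
      series x n * Y - \sum_(i < n) x i * (Y - series y (n - i)%N).
    apply/funext => n; rewrite series_cauchy_product.
    have -> : series x n = \sum_(i < n) x i by rewrite seriesEord.
    rewrite mulr_suml -sumrB.
    by apply: eq_bigr => i _; ring.
  by rewrite -[X * Y]subr0; apply: cvgB => //; apply: cvgM => //; exact: cvg_cst.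
have [E E0 HE] : exists2 E : R, 0 < E & forall n, `|Y - series y n| <= E.
  have : cvgn (fun n => Y - series y n).
    by apply/cvg_ex; exists (Y - Y); apply: cvgB => //; exact: cvg_cst.
  move=> /cvg_seq_bounded/pinfty_ex_gt0[E E0 HE].
  by exists E => // n; exact: HE.
pose A := limn [normed series x].
have A_ge n : [normed series x] n <= A.
  apply: nondecreasing_cvgn_le => //.
  by apply: nondecreasing_series => i _ _; exact: normr_ge0.
have A0 : 0 <= A by apply: le_trans (A_ge 0%N); rewrite /= /series/= big_geq.
apply/cvgrPdist_le => e e0.
pose d := e / (A + E + 1).
have AE : 0 < A + E + 1 by lra.
have d0 : 0 < d by rewrite divr_gt0.
have [J _ HJ] : \forall n \near \oo, `|Y - series y n| <= d.
  by move/cvgrPdist_le : cy => /(_ _ d0).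
have [I _ HI] : \forall n \near \oo, `|A - [normed series x] n| <= d.
  by move/cvgrPdist_le : nx => /(_ _ d0).
exists (I + J)%N => // n /= IJn; rewrite sub0r normrN.
rewrite (le_trans (ler_norm_sum _ _ _))//.
have In : (I <= n)%N by rewrite (leq_trans _ IJn)// leq_addr.
apply: (@le_trans _ _ (\sum_(0 <= i < n) `|x i| * `|Y - series y (n - i)%N|)).
  by rewrite big_mkord ler_sum// => i _; rewrite normrM.
rewrite (@big_cat_nat _ _ _ I)//=.
apply: (@le_trans _ _ (d * A + d * E)); last first.
  rewrite -mulrDr /d mulrAC ler_pdivrMr ?ler_pM2l//.
  by rewrite lerDl.
apply: lerD.
  apply: (@le_trans _ _ (\sum_(0 <= i < I) `|x i| * d)).
    rewrite !big_mkord ler_sum// => i _; rewrite ler_wpM2l// HJ//=.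
    by rewrite leq_subRL; [rewrite (leq_trans _ IJn)// leq_add2r ltnW|rewrite (leq_trans (ltnW (ltn_ord i)))].
  by rewrite -mulr_suml mulrC ler_wpM2l ?(ltW d0)//; exact: A_ge.
apply: (@le_trans _ _ (\sum_(I <= i < n) `|x i| * E)).
  by apply: ler_sum => i _; rewrite ler_wpM2l.
rewrite -mulr_suml ler_wpM2r ?(ltW E0)//.
rewrite -(sub_series_geq (fun k => `|x k|) In).
have := HI I (leqnn I); rewrite ger0_norm ?subr_ge0// => HII.
by apply: le_trans HII; apply: lerB => //; exact: A_ge.
Qed.

End cauchy_product.

(** * Series of Riemann-Liouville kernels *)

(** Weak enough to survive absolute values and Cauchy products, strong enough for Gamma in the
    denominators to win. Asking 1 <= D makes the powers of D nondecreasing, so that partial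
    exponents can be raised to the total one. *)
Definition geom_bounded (R : realType) (c : R^nat) : Prop :=
  exists K D : R, [/\ 0 <= K, 1 <= D & forall r, `|c r| <= K * D ^+ r].

Section geom_bounded.
Context {R : realType}.
Implicit Types c d : R^nat.

Lemma geom_bounded_norm c : geom_bounded c -> geom_bounded (fun r => `|c r|).
Proof.
by move=> [K [D [K0 D1 H]]]; exists K, D; split => // r; rewrite normr_id.
Qed.

Lemma geom_bounded_cauchy_product c d :
  geom_bounded c -> geom_bounded d -> geom_bounded (cauchy_product c d).
Proof.
move=> [K [D [K0 D1 H]]] [L [E [L0 E1 G]]].
have D0 : 0 <= D by exact: le_trans D1.
have E0 : 0 <= E by exact: le_trans E1.
(* The factor 2 absorbs the number of summands: m + 1 <= 2^m. *)
exists (K * L), (2 * (D * E)); split.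
- exact: mulr_ge0.
- have := mulr_ege1 D1 E1; lra.
move=> m; rewrite /cauchy_product (le_trans (ler_norm_sum _ _ _))//.
apply: (@le_trans _ _ (\sum_(i < m.+1) K * L * (D * E) ^+ m)).
  apply: ler_sum => i _; rewrite normrM exprMn mulrACA ler_pM//.
    by rewrite (le_trans (H i))// ler_wpM2l// ler_weXn2l// -ltnS.
  by rewrite (le_trans (G _))// ler_wpM2l// ler_weXn2l// leq_subr.
rewrite sumr_const card_ord -[leLHS]mulr_natr [(2 * _) ^+ m]exprMn -mulrA ler_wpM2l ?mulr_ge0//.
rewrite mulrC ler_wpM2r ?exprn_ge0 ?mulr_ge0//.
by rewrite -natrX ler_nat ltn_expl.
Qed.

End geom_bounded.

(* The Riemann-Liouville kernel of fractional integration of order a. *)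
Definition rl_kernel (R : realType) (a t : R) : R :=
  power_kernel a t / Gamma_fun a.

Section rl_kernel.
Context {R : realType}.
Implicit Types (a b t : R) (c d : R^nat).
Local Notation mu := (@lebesgue_measure R).

Lemma measurable_rl_kernel a : measurable_fun [set: R] (rl_kernel a).
Proof.
by apply: measurable_funM; [exact: measurable_power_kernel|exact: measurable_cst].
Qed.

Lemma rl_kernel_ge0 a t : 0 < a -> 0 <= rl_kernel a t.
Proof.
by move=> a0; rewrite mulr_ge0 ?power_kernel_ge0 ?invr_ge0 ?(ltW (Gamma_fun_gt0 a0)).
Qed.

Lemma rl_kernel_le0 a t : t <= 0 -> rl_kernel a t = 0.
Proof. by move=> t0; rewrite /rl_kernel power_kernel_le0// mul0r. Qed.

Lemma rl_kernelE a t : 0 < t -> rl_kernel a t = t `^ (a - 1) / Gamma_fun a.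
Proof. by move=> t0; rewrite /rl_kernel power_kernelE. Qed.

Lemma rl_kernel1 t : 0 < t -> rl_kernel 1 t = 1.
Proof. by move=> t0; rewrite rl_kernelE// subrr powRr0 Gamma_fun1 divr1. Qed.

Lemma measurable_rl_kernelM a b t :
  measurable_fun [set: R] (fun x => rl_kernel a x * rl_kernel b (t - x)).
Proof.
apply: measurable_funM; first exact: measurable_rl_kernel.
apply: measurableT_comp; first exact: measurable_rl_kernel.
exact: measurable_funB.
Qed.

Lemma rl_kernel_convolution a b t : 0 < a -> 0 < b ->
  (\int[mu]_x (rl_kernel a x * rl_kernel b (t - x))%:E)%E =
  (rl_kernel (a + b) t)%:E.
Proof.
move=> a0 b0.
have [Ga Gb] := (Gamma_fun_gt0 a0, Gamma_fun_gt0 b0).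
have Gab := Gamma_fun_gt0 (addr_gt0 a0 b0).
have k0 x : (0 <= (power_kernel a x * power_kernel b (t - x))%:E)%E.
  by rewrite lee_fin mulr_ge0 ?power_kernel_ge0.
transitivity (\int[mu]_x (((Gamma_fun a * Gamma_fun b)^-1)%:E *
    (power_kernel a x * power_kernel b (t - x))%:E))%E.
  apply: eq_integral => x _; rewrite -EFinM /rl_kernel; congr EFin.
  by rewrite invfM [RHS]mulrC mulrACA.
rewrite ge0_integralZl//; last 2 first.
- apply/measurable_EFinP; apply: measurable_funM; first exact: measurable_power_kernel.
  apply: measurableT_comp; first exact: measurable_power_kernel.
  exact: measurable_funB.
- by rewrite lee_fin invr_ge0; exact: (mulr_ge0 (ltW Ga) (ltW Gb)).
rewrite power_kernel_convolution// -EFinM; congr EFin.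
by rewrite mulrA (mulKf (mulf_neq0 (lt0r_neq0 Ga) (lt0r_neq0 Gb))) mulrC.
Qed.

Lemma normed_cvg_rl_series (nu : R) a c t : 0 < nu -> 0 < a -> geom_bounded c ->
  cvgn [normed series (fun r => c r * rl_kernel (a + nu * r%:R) t)].
Proof.
move=> nu0 a0 [K [D [K0 D1 H]]].
have [t0|t0] := ltP 0 t; last first.
  apply: (@is_cvg_near_cst _ _ 0); near=> n.
  rewrite /= /series/= big1// => i _; rewrite rl_kernel_le0// mulr0 normr0//.
have D0 : 0 < D by exact: lt_le_trans D1.
(* M is chosen so that the ratio D t^nu / M^nu is at most 1/2. *)
pose q := 2 * (D * t `^ nu).
have q0 : 0 < q by rewrite !mulr_gt0// powR_gt0.
pose M := q `^ nu^-1.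
have M0 : 0 < M by exact: powR_gt0.
have Mnu : M `^ nu = q by rewrite -powRrM mulVf ?powRr1 ?(ltW q0)// gt_eqF.
pose B := K * (t `^ (a - 1) * ((M + 1) * expR (M + 1) / M `^ a)).
have B0 : 0 <= B.
  by rewrite !mulr_ge0 ?expR_ge0 ?invr_ge0 ?powR_ge0// addr_ge0// ltW.
apply: (@series_le_cvg _ _ (geometric B 2^-1)).
- by move=> n; exact: normr_ge0.
- by move=> n; apply: geometric_ge0.
- move=> r /=.
  have ar0 : 0 < a + nu * r%:R by rewrite ltr_wpDr// mulr_ge0// ltW.
  rewrite normrM (ger0_norm (rl_kernel_ge0 _ ar0)) rl_kernelE//.
  have tD p s : t `^ (p + s) = t `^ p * t `^ s.
    by rewrite powRD// (gt_eqF t0) implybT.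
  have MD p s : M `^ (p + s) = M `^ p * M `^ s.
    by rewrite powRD// (gt_eqF M0) implybT.
  have pr x : x `^ (nu * r%:R) = (x `^ nu) ^+ r.
    by rewrite powRrM powR_mulrn// powR_ge0.
  have G : (Gamma_fun (a + nu * r%:R))^-1 <=
      (M + 1) * expR (M + 1) / (M `^ a * q ^+ r).
    have := Gamma_fun_ge M0 ar0; rewrite MD pr Mnu expRN -mulrA -invfM => G.
    have P0 : 0 < (M + 1) * expR (M + 1) by rewrite mulr_gt0 ?expR_gt0// addr_gt0.
    have Q0 : 0 < M `^ a * q ^+ r by rewrite mulr_gt0 ?exprn_gt0// powR_gt0.
    rewrite -[leRHS]invrK lef_pV2 ?posrE ?Gamma_fun_gt0//.
      by rewrite invf_div.
    by rewrite invr_gt0 divr_gt0.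
  apply: (@le_trans _ _ (K * D ^+ r * (t `^ (a - 1) * (t `^ nu) ^+ r *
      ((M + 1) * expR (M + 1) / (M `^ a * q ^+ r))))).
    rewrite ler_pM ?normr_ge0//.
      by rewrite divr_ge0 ?powR_ge0// ltW// Gamma_fun_gt0.
    rewrite (_ : a + nu * r%:R - 1 = (a - 1) + nu * r%:R); last by ring.
    rewrite (tD (a - 1)) pr ler_wpM2l// mulr_ge0 ?powR_ge0// exprn_ge0 ?powR_ge0//.
  have -> : q ^+ r = 2 ^+ r * (D ^+ r * (t `^ nu) ^+ r) by rewrite !exprMn.
  rewrite le_eqVlt; apply/orP; left; apply/eqP; rewrite /B exprVn.
  field; rewrite !expf_neq0 ?gt_eqF// powR_gt0//.
- by apply: is_cvg_geometric_series; rewrite ger0_norm// invf_lt1// ltr1n.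
Unshelve. all: by end_near. Qed.

End rl_kernel.

Lemma cvg_EFin_comp (R : realType) (u : R^nat) (l : R) :
  u @ \oo --> l -> EFin \o u @ \oo --> l%:E.
Proof. by move=> ul; apply: cvg_EFin => //; exact: nearW. Qed.

(** The sum of the |u_n| dominates all partial sums; its integral is at most the sum of the [w n],
    by the exchange theorem for nonnegative series. *)
Lemma integral_series_cvg d (T : measurableType d) (R : realType)
    (mu : {measure set T -> \bar R}) (u : nat -> T -> R) (f : T -> R)
    (v w : R^nat) (l : R) :
  (forall n, measurable_fun [set: T] (u n)) ->
  (forall x, series (u ^~ x) @ \oo --> f x) ->
  (forall n, (\int[mu]_x (u n x)%:E)%E = (v n)%:E) ->
  (forall n, (\int[mu]_x `|u n x|%:E <= (w n)%:E)%E) ->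
  cvgn (series w) -> series v @ \oo --> l ->
  (\int[mu]_x (f x)%:E)%E = l%:E.
Proof.
move=> mu_ uf uv uw cw vl.
have mau n : measurable_fun [set: T] (fun x => `|u n x|%:E).
  by apply/measurable_EFinP; exact: measurableT_comp.
have w0 n : 0 <= w n.
  by rewrite -lee_fin (le_trans _ (uw n))// integral_ge0// => x _; rewrite lee_fin.
pose g x : \bar R := (\sum_(n <oo) `|u n x|%:E)%E.
have ig : mu.-integrable setT g.
  apply/integrableP; split.
    by apply: ge0_emeasurable_sum => // n x _ _; rewrite lee_fin.
  under eq_integral.
    move=> x _; rewrite gee0_abs; last by apply: nneseries_ge0 => n _ _; rewrite lee_fin.
    over.
  rewrite integral_nneseries//.
  apply: (@le_lt_trans _ _ (\sum_(n <oo) (w n)%:E)%E).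
    apply: lee_nneseries => n *; last exact: uw.
    by apply: integral_ge0 => x _; rewrite lee_fin.
  have cW : eseries (EFin \o w) @ \oo --> (limn (series w))%:E.
    have -> : eseries (EFin \o w) = EFin \o series w.
      by apply/funext => n; rewrite /eseries /series/= sumEFin.
    exact: cvg_EFin_comp.
  by rewrite (cvg_lim _ cW)// ltry.
have iu n : mu.-integrable setT (EFin \o u n).
  apply/integrableP; split; first exact/measurable_EFinP.
  by apply: le_lt_trans (ltry (w n)); exact: uw.
have mseries n : measurable_fun [set: T] (fun x => (series (u ^~ x) n)%:E).
  by apply/measurable_EFinP; rewrite /series/=; exact: measurable_sum.
have mf : measurable_fun [set: T] (fun x => (f x)%:E).
  apply/measurable_EFinP; apply: (@measurable_fun_cvg _ _ _ setT (fun n x => series (u ^~ x) n)).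
  - by move=> n; apply/measurable_EFinP; exact: mseries.
  - by move=> x _; exact: uf.
have cvf : {ae mu, forall x, [set: T] x ->
    (series (u ^~ x) n)%:E @[n --> \oo] --> (f x)%:E}.
  by apply: aeW => x _; exact: cvg_EFin_comp.
have dom : {ae mu, forall x n, [set: T] x -> (`|(series (u ^~ x) n)%:E| <= g x)%E}.
  apply: aeW => x n _; apply: (@le_trans _ _ (\sum_(0 <= k < n) `|u k x|%:E)%E).
    by rewrite sumEFin lee_fin ler_norm_sum.
  by apply: nneseries_lim_ge => k _; rewrite lee_fin.
have [_ _ H] := dominated_convergence measurableT mseries mf cvf ig dom.
have E : (fun n => \int[mu]_x (series (u ^~ x) n)%:E)%E = EFin \o series v.
  apply/funext => n /=; rewrite /series/=.
  under eq_integral do rewrite -sumEFin.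
  rewrite integral_sum// -sumEFin; apply: eq_bigr => k _; exact: uv.
have := cvg_EFin_comp vl; rewrite -E => H'.
by rewrite -(cvg_lim _ H)//; apply/cvg_lim.
Qed.

Section rl_series.
Context {R : realType}.
Variable nu : R.
Hypothesis nu0 : 0 < nu.
Implicit Types (a b t : R) (c d : R^nat).
Local Notation mu := (@lebesgue_measure R).

Definition rl_series a c t : R :=
  limn (series (fun r => c r * rl_kernel (a + nu * r%:R) t)).

Lemma rl_exponent_gt0 a (r : nat) : 0 < a -> 0 < a + nu * r%:R.
Proof. by move=> a0; rewrite ltr_wpDr// mulr_ge0// ltW. Qed.

Lemma cvg_rl_series a c t : 0 < a -> geom_bounded c ->
  series (fun r => c r * rl_kernel (a + nu * r%:R) t) @ \oo --> rl_series a c t.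
Proof. by move=> a0 gc; apply: normed_cvg; exact: normed_cvg_rl_series. Qed.

Lemma measurable_rl_series a c : 0 < a -> geom_bounded c ->
  measurable_fun [set: R] (rl_series a c).
Proof.
move=> a0 gc; apply: (@measurable_fun_cvg _ _ _ setT
  (fun n t => series (fun r => c r * rl_kernel (a + nu * r%:R) t) n)).
- move=> n; rewrite /series/=; apply: measurable_sum => r.
  by apply: measurable_funM => //; exact: measurable_rl_kernel.
- by move=> t _; exact: cvg_rl_series.
Qed.

Lemma rl_series_le0 a c t : t <= 0 -> rl_series a c t = 0.
Proof.
move=> t0; apply: cvg_lim => //; apply: cvg_near_cst; apply: nearW => n.
by rewrite /series/= big1// => r _; rewrite rl_kernel_le0// mulr0.
Qed.

(** For fixed x the integrand is the sum of a Cauchy product. Its m-th term is a finite combination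
    of the [k i (m - i)], all of which integrate to the same kernel of order a + b + nu m. The L1
    bound is the same computation with absolute values of the coefficients. *)
Lemma rl_series_convolution a b c d t : 0 < a -> 0 < b ->
  geom_bounded c -> geom_bounded d ->
  (\int[mu]_x (rl_series a c x * rl_series b d (t - x))%:E)%E =
  (rl_series (a + b) (cauchy_product c d) t)%:E.
Proof.
move=> a0 b0 gc gd.
pose k i j x := rl_kernel (a + nu * i%:R) x * rl_kernel (b + nu * j%:R) (t - x).
have ipos a' (r : nat) : 0 < a' -> 0 < a' + nu * r%:R by exact: rl_exponent_gt0.
have k0 i j x : 0 <= k i j x by rewrite mulr_ge0// rl_kernel_ge0// ipos.
have mk i j : measurable_fun [set: R] (k i j) by exact: measurable_rl_kernelM.
have kE i j : (\int[mu]_x (k i j x)%:E)%E = (rl_kernel (a + b + nu * (i + j)%:R) t)%:E.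
  rewrite (rl_kernel_convolution t (ipos _ i a0) (ipos _ j b0)); congr (rl_kernel _ _)%:E.
  by rewrite natrD; ring.
have ik i j : mu.-integrable setT (EFin \o k i j).
  apply/integrableP; split; first by apply/measurable_EFinP; exact: mk.
  under eq_integral do rewrite /= ger0_norm//.
  by rewrite kE ltry.
pose u m x := cauchy_product (fun i => c i * rl_kernel (a + nu * i%:R) x)
  (fun j => d j * rl_kernel (b + nu * j%:R) (t - x)) m.
have uE m x : u m x = \sum_(i < m.+1) (c i * d (m - i)%N) * k i (m - i)%N x.
  by apply: eq_bigr => i _; rewrite mulrACA.
have addSB m (i : 'I_m.+1) : (i + (m - i) = m)%N by rewrite subnKC// -ltnS.
pose v e m := e m * rl_kernel (a + b + nu * m%:R) t.
have ab0 : 0 < a + b by exact: addr_gt0.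
apply: (@integral_series_cvg _ _ _ mu u _ (v (cauchy_product c d))
  (v (cauchy_product (fun r => `|c r|) (fun r => `|d r|)))).
- move=> m; rewrite (_ : u m = fun x =>
    \sum_(i < m.+1) (c i * d (m - i)%N) * k i (m - i)%N x); last exact/funext.
  by apply: measurable_sum => i; apply: measurable_funM => //; exact: mk.
- move=> x; apply: cvg_cauchy_product.
  + exact: normed_cvg_rl_series.
  + exact: cvg_rl_series.
  + exact: cvg_rl_series.
- move=> m; under eq_integral do rewrite uE -sumEFin.
  rewrite integral_sum//=; last first.
    by move=> i; under eq_fun do rewrite EFinM; apply: integrableZl => //; exact: ik.
  rewrite /v /cauchy_product mulr_suml -sumEFin; apply: eq_bigr => i _.
  under eq_integral do rewrite EFinM.
  by rewrite integralZl ?kE ?addSB//; exact: ik.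
- move=> m; apply: (@le_trans _ _
    (\int[mu]_x (\sum_(i < m.+1) (`|c i| * `|d (m - i)%N|)%:E * (k i (m - i)%N x)%:E))%E).
    apply: ge0_le_integral => //.
    + apply/measurable_EFinP; apply: measurableT_comp => //.
      rewrite (_ : u m = fun x =>
        \sum_(i < m.+1) (c i * d (m - i)%N) * k i (m - i)%N x); last exact/funext.
      by apply: measurable_sum => i; apply: measurable_funM => //; exact: mk.
    + apply: emeasurable_sum => i; apply: emeasurable_funM => //.
      apply/measurable_EFinP; exact: mk.
    + move=> x _.
      rewrite (eq_bigr (fun i : 'I_m.+1 =>
        (`|c i| * `|d (m - i)%N| * k i (m - i)%N x)%:E))//.
      rewrite sumEFin lee_fin uE.
      rewrite (le_trans (ler_norm_sum _ _ _))// ler_sum// => i _.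
      by rewrite normrM (normrM (c i)) (ger0_norm (k0 _ _ _)).
  rewrite ge0_integral_sum//; last 2 first.
  + move=> i; apply: emeasurable_funM; first exact: measurable_cst.
    by apply/measurable_EFinP; exact: mk.
  + by move=> i x _; apply: mule_ge0; rewrite lee_fin; [exact: mulr_ge0|exact: k0].
  rewrite /v /cauchy_product mulr_suml -sumEFin le_eqVlt; apply/orP; left; apply/eqP.
  by apply: eq_bigr => i _; rewrite integralZl ?kE ?addSB//; exact: ik.
- apply/cvg_ex; eexists.
  exact: (cvg_rl_series ab0 (geom_bounded_cauchy_product
    (geom_bounded_norm gc) (geom_bounded_norm gd))).
- by apply: cvg_rl_series => //; exact: geom_bounded_cauchy_product.
Qed.

End rl_series.

(** * Mittag-Leffler functions *)

(* The coefficient of x^r in (1 - x)^(-g). *)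
Definition rising_binomial (R : realType) (g : R) : R^nat :=
  fun r => rising_factorial g r / r`!%:R.

Section rising_binomial.
Context {R : realType}.
Implicit Types (g h : R) (r m : nat).

Lemma rising_binomial0 g : rising_binomial g 0 = 1.
Proof. by rewrite /rising_binomial /rising_factorial big_ord0 fact0 divr1. Qed.

(** The differential equation (1 - x) y' = g y of y = (1 - x)^(-g), read on coefficients. *)
Lemma rising_binomial_recr g r :
  r.+1%:R * rising_binomial g r.+1 = (g + r%:R) * rising_binomial g r.
Proof.
rewrite /rising_binomial /rising_factorial big_ord_recr/= factS natrM.
have f0 : r`!%:R != 0 :> R by rewrite pnatr_eq0 -lt0n fact_gt0.
have r0 : r.+1%:R != 0 :> R by rewrite pnatr_eq0.
by field; rewrite f0 addrC natr1.
Qed.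

Lemma rising_binomial_pascal g r :
  rising_binomial (g + 1) r.+1 = rising_binomial g r.+1 + rising_binomial (g + 1) r.
Proof.
rewrite /rising_binomial /rising_factorial factS natrM.
rewrite [in LHS]big_ord_recr [\prod_(i < r.+1) (g + i%:R)]big_ord_recl/= addr0.
rewrite [\prod_(i < r) (g + (bump _ _)%:R)](eq_bigr (fun i : 'I_r => g + 1 + i%:R));
  last by move=> i _; rewrite /bump leq0n natrD addrA.
have f0 : r`!%:R != 0 :> R by rewrite pnatr_eq0 -lt0n fact_gt0.
have r0 : r%:R + 1 != 0 :> R by rewrite natr1 pnatr_eq0. 
by rewrite -(natr1 r); field; rewrite f0 r0.
Qed.

(** The Chu-Vandermonde identity, that is (1 - x)^(-g) (1 - x)^(-h) = (1 - x)^(-g-h). Both sides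
    satisfy the same first-order recurrence. *)
Lemma cauchy_product_rising_binomial g h :
  cauchy_product (rising_binomial g) (rising_binomial h) = rising_binomial (g + h).
Proof.
apply/funext; elim=> [|m IH].
  by rewrite /cauchy_product big_ord_recl big_ord0 !rising_binomial0 addr0 mulr1.
have m0 : m.+1%:R != 0 :> R by rewrite pnatr_eq0.
apply: (mulfI m0); rewrite rising_binomial_recr -IH /cauchy_product.
pose p := rising_binomial g; pose q := rising_binomial h.
rewrite -/p -/q mulr_sumr.
(* Leibniz' rule: the factor m + 1 splits as i + (m + 1 - i). Each sum then loses a vanishing end
   term, the recurrence applies inside, and the factors g + i and h + (m - i) add up to g + h +
   m. *)
transitivity (\sum_(i < m.+2) (i%:R * p i) * q (m.+1 - i)%N +
    \sum_(i < m.+2) p i * ((m.+1 - i)%:R * q (m.+1 - i)%N)).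
  rewrite -big_split/=; apply: eq_bigr => i _.
  have {1}-> : m.+1 = (i + (m.+1 - i))%N by rewrite subnKC// -ltnS.
  by rewrite natrD; ring.
rewrite big_ord_recl/= !mul0r add0r [X in _ + X]big_ord_recr/= subnn mul0r mulr0 addr0.
rewrite -big_split/= mulr_sumr; apply: eq_bigr => i _.
have im : (i <= m)%N by rewrite -ltnS.
rewrite /bump leq0n add1n subSS rising_binomial_recr subSn//.
rewrite rising_binomial_recr -/p -/q.
rewrite natrB//; ring.
Qed.

Lemma rising_binomial_ge0 g r : 0 <= g -> 0 <= rising_binomial g r.
Proof.
by move=> g0; rewrite divr_ge0// prodr_ge0// => i _; rewrite addr_ge0.
Qed.

(** The recurrence multiplies by (g + r) / (r + 1) at each step, and this is at most g + 1. *)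
Lemma rising_binomial_le g r : 0 <= g -> rising_binomial g r <= (g + 1) ^+ r.
Proof.
move=> g0; elim: r => [|r IH]; first by rewrite rising_binomial0 expr0.
have r0 : 0 < r.+1%:R :> R by rewrite ltr0n.
rewrite -(ler_pM2l r0) rising_binomial_recr exprS [leRHS]mulrA.
have gr0 : 0 <= g + r%:R by exact: addr_ge0.
have p0 : 0 <= rising_binomial g r by exact: rising_binomial_ge0.
have gr : g + r%:R <= r.+1%:R * (g + 1).
  have : 0 <= r%:R * g by rewrite mulr_ge0.
  by rewrite -natr1; nra.
exact: (ler_pM gr0 p0 gr IH).
Qed.

End rising_binomial.

(** The coefficients of K (1 - z x)^(-g). The constant K carries the power of lambda, so that it
    multiplies along with the Cauchy product. *)
Definition ml_weight (R : realType) (K g z : R) : R^nat :=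
  fun r => K * (rising_binomial g r * z ^+ r).

Section mittag_leffler.
Context {R : realType}.
Variable nu : R.
Hypothesis nu0 : 0 < nu.
Implicit Types (a b g h z K L t : R).

Lemma geom_bounded_ml_weight K g z : 0 <= g -> geom_bounded (ml_weight K g z).
Proof.
move=> g0; exists `|K|, ((g + 1) * (`|z| + 1)); split => //.
- by apply: mulr_ege1; rewrite lerDr.
move=> r; rewrite /ml_weight (normrM K) (normrM (rising_binomial g r)) normrX.
rewrite exprMn; apply: ler_wpM2l => //; apply: ler_pM; rewrite ?exprn_ge0//.
  by rewrite ger0_norm ?rising_binomial_le// rising_binomial_ge0.
by rewrite lerXn2r ?nnegrE ?addr_ge0// lerDl.
Qed.

Lemma cauchy_product_ml_weight K L g h z :
  cauchy_product (ml_weight K g z) (ml_weight L h z) = ml_weight (K * L) (g + h) z.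
Proof.
apply/funext => m; rewrite /ml_weight -cauchy_product_rising_binomial /cauchy_product.
rewrite mulr_suml mulr_sumr; apply: eq_bigr => i _.
have -> : z ^+ m = z ^+ i * z ^+ (m - i) by rewrite -exprD subnKC// -ltnS.
by ring.
Qed.

(** At t = 1 the powers in the kernels disappear and only the reciprocal Gamma values remain, so
    convergence of the Mittag-Leffler series is a case of [cvg_rl_series]. *)
Lemma mittag_leffler_coeffE b g z : mittag_leffler_coeff nu b g z =
  fun r => ml_weight 1 g z r * rl_kernel (b + nu * r%:R) 1.
Proof.
apply/funext => r; rewrite /mittag_leffler_coeff /ml_weight /rising_binomial.
by rewrite rl_kernelE//= powR1 (addrC b) invfM; ring.
Qed.

Lemma cvg_mittag_leffler b g z : 0 < b -> 0 <= g ->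
  series (mittag_leffler_coeff nu b g z) @ \oo --> mittag_leffler nu b g z.
Proof.
move=> b0 g0; have := cvg_rl_series nu0 (t := 1) b0 (geom_bounded_ml_weight 1 z g0).
by rewrite /mittag_leffler /rl_series -mittag_leffler_coeffE.
Qed.

Lemma rl_series_ml_weight a K g z t : 0 < t -> 0 < a -> 0 <= g ->
  rl_series nu a (ml_weight K g z) t =
  K * t `^ (a - 1) * mittag_leffler nu a g (z * t `^ nu).
Proof.
move=> t0 a0 g0; rewrite /rl_series.
rewrite (_ : (fun r => _) = (K * t `^ (a - 1)) *:
    mittag_leffler_coeff nu a g (z * t `^ nu)); last first.
  apply/funext => r; rewrite mittag_leffler_coeffE; apply/esym.
  rewrite -[LHS]/((K * t `^ (a - 1)) * (ml_weight 1 g (z * t `^ nu) r *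
    rl_kernel (a + nu * r%:R) 1)).
  rewrite !rl_kernelE// powR1 /ml_weight exprMn.
  rewrite (_ : a + nu * r%:R - 1 = (a - 1) + nu * r%:R); last by ring.
  rewrite [in RHS]powRD; last by rewrite (gt_eqF t0) implybT.
  by rewrite powRrM powR_mulrn ?powR_ge0//; ring.
have cm := @cvg_mittag_leffler a g (z * t `^ nu) a0 g0.
by apply: cvg_lim => //; rewrite seriesZ; apply: cvgZr; exact: cm.
Qed.

(** In the coefficient with index r - 1, shifting the index costs a factor z and moves the offset
    from b to b + nu. Hence n + 1 terms of two of the series are compared with n terms of the
    third. *)
Lemma mittag_leffler_pascal b g z : 0 < b -> 0 <= g ->
  mittag_leffler nu b g z =
  mittag_leffler nu b (g + 1) z - z * mittag_leffler nu (b + nu) (g + 1) z.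
Proof.
move=> b0 g0; have g1 : 0 <= g + 1 by rewrite addr_ge0.
have c1 := @cvg_mittag_leffler b (g + 1) z b0 g1.
have c2 := @cvg_mittag_leffler (b + nu) (g + 1) z (addr_gt0 b0 nu0) g1.
apply: cvg_lim => //.
rewrite -cvg_shiftS.
have -> : (fun n => series (mittag_leffler_coeff nu b g z) n.+1) =
    fun n => series (mittag_leffler_coeff nu b (g + 1) z) n.+1 -
      z * series (mittag_leffler_coeff nu (b + nu) (g + 1) z) n.
  apply/funext => n; rewrite /series/= !big_nat_recl//= !mittag_leffler_coeffE.
  rewrite /ml_weight !rising_binomial0 mulr_sumr -addrA; congr +%R.
  rewrite -sumrB; apply: eq_bigr => i _.
  rewrite rising_binomial_pascal (_ : b + nu + nu * i%:R = b + nu * i.+1%:R); last first.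
    by rewrite -natr1; ring.
  by rewrite exprS; ring.
have c1' : series (mittag_leffler_coeff nu b (g + 1) z) n.+1 @[n --> \oo] -->
    mittag_leffler nu b (g + 1) z.
  by have := c1; rewrite -cvg_shiftS; exact.
by apply: cvgB; [exact: c1'|apply: cvgM; [exact: cvg_cst|exact: c2]].
Qed.

(** The degenerate case g = 0: (0)_r contains the factor 0 once r > 0. It serves both T_0 = 0 and
    the unit of the Cauchy product. *)
Lemma mittag_leffler_0 z : mittag_leffler nu 1 0 z = 1.
Proof.
apply: cvg_lim => //; rewrite -cvg_shiftS; apply: cvg_near_cst; apply: nearW => n.
rewrite /series/= big_nat_recl//= big1 => [|i _].
  rewrite mittag_leffler_coeffE /ml_weight rising_binomial0 mulr0n mulr0.
  by rewrite !addr0 rl_kernel1// expr0 !mulr1.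
rewrite mittag_leffler_coeffE /ml_weight /rising_binomial /rising_factorial.
by rewrite big_ord_recl/= addr0 !mul0r mulr0 mul0r.
Qed.

End mittag_leffler.

(** * Sums of independent random variables *)

Section joint_law.
Context d d1 d2 (T : measurableType d) (T1 : measurableType d1)
  (T2 : measurableType d2) (R : realType).
Variables (m : {measure set T -> \bar R}) (X : T -> T1) (Y : T -> T2).
Hypotheses (mX : measurable_fun [set: T] X) (mY : measurable_fun [set: T] Y).

(* m need not be a probability: it is also applied to P restricted to an event. *)
Lemma joint_law_product (m1 : {sigma_finite_measure set T1 -> \bar R})
    (m2 : {sigma_finite_measure set T2 -> \bar R}) :
  (forall A B, measurable A -> measurable B ->
     m (X @^-1` A `&` Y @^-1` B) = (m1 A * m2 B)%E) ->
  forall E, measurable E -> m [set w | E (X w, Y w)] = (m1 \x m2)%E E.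
Proof.
move=> mXY E mE.
have mXYf : measurable_fun [set: T] (fun w => (X w, Y w)) by exact: measurable_fun_pair.
pose pf : {measure set (T1 * T2) -> \bar R} := pushforward m (fun w => (X w, Y w)).
have -> : m [set w | E (X w, Y w)] = pf mXYf E by [].
by apply/esym; apply: product_measure_unique => // A B mA mB; exact: mXY.
Qed.

End joint_law.

Lemma measurable_addr_preimage (R : realType) (A : set R) : measurable A ->
  measurable [set p : R * R | A (p.1 + p.2)].
Proof.
move=> mA.
have madd : measurable_fun [set: R * R] (fun p : R * R => p.1 + p.2).
  by apply: measurable_funD; [exact: measurable_fst|exact: measurable_snd].
by have := madd measurableT A mA; rewrite setTI.
Qed.

(* Future coordinates stay in the event, so that the step from T_k to T_(k+1)
   can absorb U k. *)
Lemma mutually_independent_arrival_time d (T : measurableType d) (R : realType)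
    (P : probability T R) (U : nat -> {RV P >-> R}) :
  mutually_independent U ->
  forall (k : nat) (J : {fset nat}) (B : nat -> set R) (A : set R),
    (forall j, measurable (B j)) -> (forall j, j \in J -> (k <= j)%N) ->
    measurable A ->
    (P (arrival_time U k @^-1` A `&` \bigcap_(j in [set` J]) (U j @^-1` B j)) =
     P (arrival_time U k @^-1` A) * P (\bigcap_(j in [set` J]) (U j @^-1` B j)))%E.
Proof.
move=> indU; elim=> [|k IH] J B A mB leJ mA.
  have [A0|A0] := pselect (A 0).
    have -> : arrival_time U 0 @^-1` A = setT.
      by apply/seteqP; split => w //= _; rewrite /arrival_time big_ord0.
    by rewrite setTI probability_setT mul1e.
  have -> : arrival_time U 0 @^-1` A = set0.
    by apply/seteqP; split => w //=; rewrite /arrival_time big_ord0.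
  by rewrite set0I measure0 mul0e.
set F := \bigcap_(j in _) _.
have mU j C : measurable C -> measurable (U j @^-1` C).
  by move=> mC; rewrite -[X in measurable X]setTI; exact: measurable_funPT.
have mT j C : measurable C -> measurable (arrival_time U j @^-1` C).
  by move=> mC; rewrite -[X in measurable X]setTI; exact: measurable_arrival_time.
have mF : measurable F.
  apply: fin_bigcap_measurable; first exact: finite_fset.
  by move=> j _; exact: mU.
have PF0 : 0 <= fine (P F) by exact: fine_ge0.
pose c : {nonneg R} := NngNum PF0.
have cE : (c%:num)%:E = P F by rewrite /= fineK// fin_num_measure.
have kJ : k \notin J by apply/negP => /leJ; rewrite ltnn.
have rect C D : measurable C -> measurable D ->
    (P (arrival_time U k @^-1` C `&` U k @^-1` D `&` F) =
     P (arrival_time U k @^-1` C) * (P (U k @^-1` D) * P F))%E.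
  (* The event on U_k is added to the future ones, which the induction hypothesis at k allows; k is
     new there because J only holds larger indices. *)
  move=> mC mD; pose B' j := if j == k then D else B j.
  have mB' j : measurable (B' j) by rewrite /B'; case: ifP.
  have FE : \bigcap_(j in [set` J]) (U j @^-1` B' j) = F.
    apply: eq_bigcapr => j /= jJ; rewrite /B'; case: eqP => // jk.
    by move: kJ; rewrite -jk jJ.
  have F'E : \bigcap_(j in [set` (k |` J)%fset]) (U j @^-1` B' j) = U k @^-1` D `&` F.
    rewrite -FE; apply/seteqP; split => w /=.
      move=> H; split.
        by have := H k; rewrite /= /B' eqxx; apply; rewrite !inE eqxx.
      by move=> j jJ; apply: H; rewrite /= in_fset1U jJ orbT.
    move=> [Hk H] j /=; rewrite in_fset1U => /orP[/eqP ->|jJ].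
      by rewrite /B' eqxx.
    exact: H.
  rewrite -setIA -F'E IH//; last first.
    by move=> j; rewrite in_fset1U => /orP[/eqP ->//|/leJ/ltnW].
  rewrite indU// big_fsetU1//=; congr (_ * (_ * _))%E.
    by rewrite /B' eqxx.
  by rewrite -indU// FE.
pose E := [set p : R * R | A (p.1 + p.2)].
have mE : measurable E by exact: measurable_addr_preimage.
have mX : measurable_fun [set: T] (arrival_time U k) by exact: measurable_arrival_time.
have mY : measurable_fun [set: T] (U k) by exact: measurable_funPT.
have TE : arrival_time U k.+1 @^-1` A = [set w | E (arrival_time U k w, U k w)].
  by apply/seteqP; split => w; rewrite /E /= /arrival_time big_ord_recr.
(* P restricted to F, and P scaled by P(F), give (T_k, U_k) the same product law [m1 \x m2];
   evaluating both on the event T_k + U_k in A gives the factorization. *)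
pose m1 := distribution P (arrival_time U k).
pose m2 := mscale c (distribution P (U k)).
have L := @joint_law_product _ _ _ T R R R (mrestr P mF) _ _ mX mY m1 m2.
have {}L := L _ E mE.
have M := @joint_law_product _ _ _ T R R R (mscale c P) _ _ mX mY m1 m2.
have {}M := M _ E mE.
rewrite TE; transitivity ((m1 \x m2)%E E).
  apply: L => C D mC mD; apply: etrans (rect C D mC mD) _.
  by rewrite -[in LHS]cE [X in (_ * X)%E]muleC.
rewrite -M => [|C D mC mD].
  by rewrite [RHS]muleC -[in RHS]cE.
rewrite [RHS]muleCA; congr (_ * _)%E.
have := IH [fset k]%fset (fun=> D) C.
rewrite set_fset1 bigcap_set1; apply => //.
by move=> j; rewrite inE => /eqP ->.
Qed.

Section density_of_sum.
Context {R : realType}.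
Local Notation mu := (@lebesgue_measure R).
Implicit Types f g : R -> R.

Lemma measurable_density_joint f g :
  measurable_fun [set: R] f -> measurable_fun [set: R] g ->
  measurable_fun [set: R * R] (fun p : R * R => (f p.1 * g p.2)%:E).
Proof.
move=> mf mg; apply/measurable_EFinP; apply: measurable_funM.
  by apply: measurableT_comp => //; exact: measurable_fst.
by apply: measurableT_comp => //; exact: measurable_snd.
Qed.

(** Integrating f(x) g(y) over a set defines a measure on the plane that agrees with [m1 \x m2] on
    rectangles, hence everywhere. *)
Lemma product_measure_density (m1 m2 : {sigma_finite_measure set R -> \bar R}) f g :
  measurable_fun [set: R] f -> measurable_fun [set: R] g ->
  (forall x, 0 <= f x) -> (forall x, 0 <= g x) ->
  (forall A, measurable A -> m1 A = \int[mu]_(x in A) (f x)%:E)%E ->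
  (forall A, measurable A -> m2 A = \int[mu]_(x in A) (g x)%:E)%E ->
  forall E : set (R * R), measurable E ->
  (m1 \x m2)%E E = (\int[mu]_x \int[mu]_y (\1_E (x, y) * (f x * g y))%:E)%E.
Proof.
move=> mf mg f0 g0 m1f m2g E mE.
have mfg := measurable_density_joint mf mg.
have fg0 p : (0 <= (f p.1 * g p.2)%:E)%E by rewrite lee_fin mulr_ge0.
pose nu (A : set (R * R)) := (\int[mu \x mu]_(p in A) (f p.1 * g p.2)%:E)%E.
have nu0 : nu set0 = 0%E by rewrite /nu integral_set0.
have nu_ge0 A : (0 <= nu A)%E by apply: integral_ge0 => p _; exact: fg0.
have nu_sigma : semi_sigma_additive nu.
  exact: (@semi_sigma_additive_nng_induced _ _ R (mu \x mu)%E _ mfg fg0).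
pose mix := isMeasure.Build _ _ _ nu nu0 nu_ge0 nu_sigma.
pose nuM : {measure set (R * R) -> \bar R} := HB.pack nu mix.
have nuE A : measurable A ->
    nu A = (\int[mu]_x \int[mu]_y (\1_A (x, y) * (f x * g y))%:E)%E.
  move=> mA; rewrite /nu integral_mkcond.
  have -> : (fun p : R * R => (f p.1 * g p.2)%:E) \_ A =
      fun p => (\1_A p * (f p.1 * g p.2))%:E.
    apply/funext => p; rewrite patchE indicE.
    by case: ifPn => pA; rewrite ?mul1r ?mul0r.
  have mh : measurable_fun [set: R * R]
      (fun p : R * R => (\1_A p * (f p.1 * g p.2))%:E).
    apply/measurable_EFinP; apply: measurable_funM => //.
    exact/measurable_EFinP.
  rewrite (@fubini_tonelli1 _ _ _ _ R mu mu _ mh)//.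
  by move=> p; rewrite lee_fin mulr_ge0// mulr_ge0.
rewrite -nuE// -[RHS]/(nuM E); apply: product_measure_unique => // A B mA mB.
rewrite -[LHS]/(nu _) nuE; last exact: measurableX.
rewrite m1f// m2g//.
have mfA : measurable_fun [set: R] ((EFin \o f) \_ A).
  apply: (measurable_restrictT (EFin \o f) mA).1.
  by apply: measurable_funTS; exact/measurable_EFinP.
have mgB : measurable_fun [set: R] ((EFin \o g) \_ B).
  apply: (measurable_restrictT (EFin \o g) mB).1.
  by apply: measurable_funTS; exact/measurable_EFinP.
have fA0 x : (0 <= ((EFin \o f) \_ A) x)%E.
  by rewrite patchE; case: ifP => //= _; rewrite lee_fin.
have gB0 x : (0 <= ((EFin \o g) \_ B) x)%E.
  by rewrite patchE; case: ifP => //= _; rewrite lee_fin.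
rewrite [in RHS]integral_mkcond [X in (_ * X)%E]integral_mkcond.
rewrite -ge0_integralZr//; last exact: integral_ge0.
apply: eq_integral => x _; rewrite -ge0_integralZl//.
apply: eq_integral => y _; rewrite !patchE indicE in_setX.
case: (x \in A) => /=; last by rewrite !mul0r mul0e.
by case: (y \in B) => /=; rewrite ?mul1r ?mul0r ?mule0// EFinM.
Qed.

End density_of_sum.

Section has_density_pos_sum.
Context d (T : measurableType d) (R : realType) (P : probability T R).
Local Notation mu := (@lebesgue_measure R).
Implicit Types X Y Z : {RV P >-> R}.

Lemma has_density_pos_patch X (f : R -> R) : has_density_pos P X f ->
  forall A, measurable A ->
  distribution P X A = (\int[mu]_(x in A) ((f \_ `]0%R, +oo[) x)%:E)%E.
Proof.
move=> [_ _ H] A mA; rewrite H// integral_mkcondr.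
by apply: eq_integral => x _; rewrite !patchE; case: ifP.
Qed.

Lemma has_density_posD X Y Z (f g h : R -> R) :
  (forall w, Z w = X w + Y w) ->
  (forall A B : set R, measurable A -> measurable B ->
     P (X @^-1` A `&` Y @^-1` B) = (P (X @^-1` A) * P (Y @^-1` B))%E) ->
  measurable_fun (`]0, +oo[ : set R) h ->
  (forall t, 0 < t ->
     (\int[mu]_x ((f \_ `]0%R, +oo[) x * (g \_ `]0%R, +oo[) (t - x))%:E)%E = (h t)%:E) ->
  has_density_pos P X f -> has_density_pos P Y g -> has_density_pos P Z h.
Proof.
move=> ZE indXY mh hE dX dY.
set f' := f \_ _ in hE *; set g' := g \_ _ in hE *.
have mf' : measurable_fun [set: R] f'.
  by case: dX => mf _ _; apply: (measurable_restrictT f _).1.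
have mg' : measurable_fun [set: R] g'.
  by case: dY => mg _ _; apply: (measurable_restrictT g _).1.
have pos (u : R -> R) : (forall t, 0 < t -> 0 <= u t) ->
    forall x, 0 <= (u \_ `]0%R, +oo[) x.
  move=> u0 x; rewrite patchE; case: ifPn => //.
  by rewrite inE/= in_itv/= andbT; exact: u0.
have f0 x : 0 <= f' x by case: dX => _ f0 _; exact: pos.
have g0 x : 0 <= g' x by case: dY => _ g0 _; exact: pos.
split => //.
  (* Nonnegativity of h is not assumed: it is read off the convolution integral. *)
  move=> t t0; rewrite -lee_fin -hE//; apply: integral_ge0 => x _.
  by rewrite lee_fin mulr_ge0.
move=> A mA.
pose E := [set p : R * R | A (p.1 + p.2)].
have mE : measurable E by exact: measurable_addr_preimage.
have -> : distribution P Z A = P [set w | E (X w, Y w)].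
  by congr (P _); apply/seteqP; split => w; rewrite /E /= ZE.
rewrite (@joint_law_product _ _ _ T R R R P X Y (measurable_funPT X)
  (measurable_funPT Y) (distribution P X) (distribution P Y))//.
rewrite (@product_measure_density R (distribution P X) (distribution P Y) f' g')//;
  try exact: has_density_pos_patch.
transitivity (\int[mu]_x \int[mu]_y (\1_A (x + y) * (f' x * g' y))%:E)%E.
  apply: eq_integral => x _; apply: eq_integral => y _; rewrite !indicE.
  by congr ((nat_of_bool _)%:R * _)%:E; apply/idP/idP; rewrite !inE.
rewrite (ge0_integral_convolution (phi := \1_A))//.
rewrite [RHS]integral_mkcond; apply: eq_integral => z _.
rewrite patchE indicE in_setI.
case: (z \in A) => /=; last by rewrite mul0e.
rewrite mul1e; case: ifPn => [|].
  by rewrite inE/= in_itv/= andbT => z0; rewrite hE.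
rewrite notin_setE/= in_itv/= andbT => /negP; rewrite -leNgt => z0.
(* For z <= 0, x and z - x cannot both be positive, so one of the two extended densities
   vanishes. *)
apply: integral0_eq => x _.
have [x0|x0] := leP x 0.
  by rewrite /f' patchE memNset ?mul0r//= in_itv/= andbT; apply/negP; rewrite -leNgt.
rewrite /g' [X in _ * X]patchE memNset ?mulr0//= in_itv/= andbT.
by apply/negP; rewrite -leNgt; lra.
Qed.

End has_density_pos_sum.

(** * The renewal process *)

Section f_hat_series.
Context {R : realType}.
Variables lambda nu : R.
Hypothesis nu0 : 0 < nu.
Implicit Types (k : nat) (t : R).
Local Notation mu := (@lebesgue_measure R).

Let f_series k : R -> R :=
  rl_series nu (2 * nu * k%:R) (ml_weight (lambda ^+ (2 * k)) (2 * k%:R) (- lambda)).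

Lemma f_hat1E : f_hat1 lambda nu = f_hat lambda nu 1.
Proof. by apply/funext => t; rewrite /f_hat1 /f_hat !mulr1 muln1. Qed.

Lemma f_hat_exponent_gt0 k : (0 < k)%N -> 0 < 2 * nu * k%:R.
Proof. by move=> k0; rewrite !mulr_gt0// ltr0n. Qed.

Let patch_f_hat k t : (0 < k)%N ->
  (f_hat lambda nu k \_ `]0, +oo[) t = f_series k t.
Proof.
move=> k0; rewrite patchE; case: ifPn.
  rewrite inE/= in_itv/= andbT => t0.
  by rewrite /f_series rl_series_ml_weight ?mulr_ge0// f_hat_exponent_gt0.
rewrite notin_setE/= in_itv/= andbT => /negP; rewrite -leNgt => t0.
by rewrite /f_series rl_series_le0.
Qed.

Lemma f_hat_convolution k t : (0 < k)%N -> 0 < t ->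
  (\int[mu]_x ((f_hat lambda nu k \_ `]0%R, +oo[) x *
     (f_hat1 lambda nu \_ `]0%R, +oo[) (t - x))%:E)%E = (f_hat lambda nu k.+1 t)%:E.
Proof.
move=> k0 t0.
transitivity (\int[mu]_x (f_series k x * f_series 1 (t - x))%:E)%E.
  apply: eq_integral => x _; rewrite f_hat1E; congr (_ * _)%:E.
    exact: (patch_f_hat x k0).
  exact: (patch_f_hat (t - x) (ltn0Sn 0)).
have a0 := f_hat_exponent_gt0 k0; have b0 := f_hat_exponent_gt0 (ltn0Sn 0).
rewrite rl_series_convolution//; try by apply: geom_bounded_ml_weight; rewrite mulr_ge0.
rewrite cauchy_product_ml_weight.
have g0 : 0 <= 2 * k%:R + 2 * 1%:R :> R by rewrite addr_ge0// mulr_ge0.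
rewrite (rl_series_ml_weight nu0 _ _ t0 (addr_gt0 a0 b0) g0).
rewrite /f_hat -exprD; congr (_ ^+ _ * _ `^ _ * mittag_leffler _ _ _ _)%:E.
- by rewrite -mulnDr addn1.
- by rewrite -(natr1 k); ring.
- by rewrite -(natr1 k); ring.
- by rewrite -(natr1 k); ring.
Qed.

Lemma measurable_f_hat k : (0 < k)%N ->
  measurable_fun (`]0, +oo[ : set R) (f_hat lambda nu k).
Proof.
move=> k0; apply: (measurable_restrictT (f_hat lambda nu k) (measurable_itv _)).2.
apply: (eq_measurable_fun (f_series k)).
  by move=> t _; apply/esym; exact: patch_f_hat.
apply: measurable_rl_series => //.
  exact: f_hat_exponent_gt0.
by apply: geom_bounded_ml_weight; rewrite mulr_ge0.
Qed.

(** Pr(T_k < t): integrating [f_hat] raises the offset by 1 and leaves the parameter 2k alone. The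
    formula also covers k = 0, where it gives 1 for t > 0. *)
Definition arrival_cdf k t : R :=
  lambda ^+ (2 * k) * t `^ (2 * k%:R * nu)
    * mittag_leffler nu (2 * k%:R * nu + 1) (2 * k%:R) (- lambda * t `^ nu).

Lemma integral_f_hat k t : (0 < k)%N -> 0 < t ->
  (\int[mu]_(x in `]-oo, t[ `&` `]0%R, +oo[) (f_hat lambda nu k x)%:E)%E =
  (arrival_cdf k t)%:E.
Proof.
move=> k0 t0.
have a0 := f_hat_exponent_gt0 k0.
have g0 : 0 <= 2 * k%:R :> R by rewrite mulr_ge0.
(* Since ml_weight 1 0 z is the unit of the Cauchy product, rl_series nu 1 of it
   is the indicator of ]0, +oo[. *)
transitivity (\int[mu]_x (f_series k x *
    rl_series nu 1 (ml_weight 1 0 (- lambda)) (t - x))%:E)%E.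
  rewrite integral_mkcond; apply: eq_integral => x _.
  rewrite -(patch_f_hat x k0) !patchE in_setI; case: (x \in `]0%R, +oo[%classic) => /=;
    last by rewrite andbF mul0r.
  rewrite andbT; have [xt|tx] := ltP x t.
    rewrite mem_set/= ?in_itv//= rl_series_ml_weight ?subr_gt0//.
    by rewrite mittag_leffler_0// subrr powRr0 !mulr1.
  rewrite rl_series_le0 ?subr_le0// mulr0 memNset//= in_itv/=.
  by apply/negP; rewrite -leNgt.
rewrite rl_series_convolution//; try exact: geom_bounded_ml_weight.
rewrite cauchy_product_ml_weight mulr1 addr0.
rewrite (rl_series_ml_weight nu0 _ _ t0 (addr_gt0 a0 ltr01) g0).
by rewrite addrK /arrival_cdf (mulrAC 2 k%:R nu).
Qed.

(** The two summands of [p_hat] telescope through lambda^(2k+1) t^((2k+1) nu) E^(2k+1) with offset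
    (2k+1) nu + 1: Pascal's rule at g = 2k makes the first summand [arrival_cdf k t] minus this
    quantity, and at g = 2k + 1 the second is this quantity minus [arrival_cdf k.+1 t]. The sign of
    z supplies the extra factor lambda t^nu. *)
Lemma p_hat_arrival_cdf k t : 0 < t ->
  p_hat lambda nu k t = arrival_cdf k t - arrival_cdf k.+1 t.
Proof.
move=> t0; rewrite /p_hat /arrival_cdf.
have b0 : 0 < 2 * k%:R * nu + 1 by rewrite ltr_wpDl// !mulr_ge0// ltW.
have g0 : 0 <= 2 * k%:R :> R by rewrite mulr_ge0.
set z := - lambda * t `^ nu.
have p1 := mittag_leffler_pascal nu0 z b0 g0.
have p2 := mittag_leffler_pascal nu0 z (addr_gt0 b0 nu0) (addr_ge0 g0 ler01).
rewrite p1 p2 {p1 p2}.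
have -> : 2 * k.+1%:R = 2 * k%:R + 1 + 1 :> R by rewrite -natr1; ring.
have -> : 2 * k%:R + 2 = 2 * k%:R + 1 + 1 :> R by ring.
have -> : (2 * k%:R + 1 + 1) * nu + 1 = 2 * k%:R * nu + 1 + nu + nu by ring.
have -> : (2 * k%:R + 1) * nu + 1 = 2 * k%:R * nu + 1 + nu by ring.
have tD r s : t `^ (r + s) = t `^ r * t `^ s.
  by rewrite powRD// (gt_eqF t0) implybT.
have -> : (2 * k%:R + 1) * nu = 2 * k%:R * nu + nu by ring.
have -> : (2 * k%:R + 1 + 1) * nu = 2 * k%:R * nu + nu + nu by ring.
rewrite !tD mulnS (exprD _ 2 (2 * k)) (exprD _ (2 * k) 1) expr1 expr2.
set M1 := mittag_leffler _ _ _ _; set M2 := mittag_leffler _ _ _ _.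
set M3 := mittag_leffler _ _ _ _; clearbody M1 M2 M3; rewrite /z; ring.
Qed.

End f_hat_series.

Theorem mainTheorem5 (R : realType) (lambda nu : R)
    (lambda_gt0 : 0 < lambda) (nu_gt0 : 0 < nu) (nu_le1 : nu <= 1)
    (d : measure_display) (T : measurableType d) (P : probability T R)
    (U : nat -> {RV P >-> R})
    (U_iid : iid U)
    (U_pos : forall j : nat, {ae P, forall w : T, 0 < U j w})
    (U_density : forall j : nat, has_density_pos P (U j) (f_hat1 lambda nu)) :
  (forall k : nat, (1 <= k)%N ->
     has_density_pos P (arrival_time U k) (f_hat lambda nu k)) /\
  (forall (k : nat) (t : R), 0 < t ->
     (p_hat lambda nu k t)%:E =
       (P [set w | (arrival_time U k w < t)%R]
        - P [set w | (arrival_time U k.+1 w < t)%R])%E).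
Proof.
have density k : (1 <= k)%N ->
    has_density_pos P (arrival_time U k) (f_hat lambda nu k).
  (* The induction starts at k = 1, since the constant T_0 = 0 has no density. *)
  elim: k => // -[_ _|k IH _].
    rewrite -f_hat1E; have [mf f0 H] := U_density 0; split => // A mA.
    rewrite -H//; congr (P _); apply/seteqP.
    by split => w; rewrite /= /arrival_time big_ord1.
  apply: (has_density_posD (X := arrival_time U k.+1) (Y := U k.+1) _ _ _ _
    (IH isT) (U_density k.+1)).
  - by move=> w; rewrite /= /arrival_time big_ord_recr.
  - move=> A B mA mB; have [indU _] := U_iid.
    have := mutually_independent_arrival_time indU (k := k.+1)
      (J := [fset k.+1]%fset) (B := fun=> B) (A := A).
    rewrite set_fset1 bigcap_set1; apply => //.
    by move=> j; rewrite inE => /eqP ->.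
  - exact: measurable_f_hat.
  - by move=> t t0; exact: f_hat_convolution.
split => // k t t0.
have cdf j : P [set w | arrival_time U j w < t] = (arrival_cdf lambda nu j t)%:E.
  (* For j = 0 the event 0 < t is certain, and the formula reduces to the Mittag-Leffler function
     with g = 0 and offset 1. *)
  case: j => [|j].
    rewrite /arrival_cdf !muln0 !mulr0 !mul0r add0r powRr0 mittag_leffler_0//.
    rewrite expr0 !mulr1 -(probability_setT P); congr (P _).
    by apply/seteqP; split => w //= _; rewrite /arrival_time big_ord0.
  have [_ _ H] := density j.+1 isT.
  by rewrite -integral_f_hat// -H//; congr (P _).
by rewrite p_hat_arrival_cdf// EFinB !cdf.
Qed.
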